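(* Let $\mathcal{M}$ be the family of $3$-graphs defined in the context. Then $\mathrm{ex}(n,\mathcal{M}) \le 2n^3/27$ for every positive integer $n$. Moreover, $\mathrm{ex}(n,\mathcal{M}) = 2n^3/27$ whenever $n$ is a multiple of six.
   Context: An $r$-graph is an $r$-uniform hypergraph. For a family $\mathcal{F}$ of $r$-graphs, an $r$-graph is $\mathcal{F}$-free if it contains no member of $\mathcal{F}$ as a (not necessarily induced) subgraph, and $\mathrm{ex}(n,\mathcal{F})$ is the maximum number of edges of an $\mathcal{F}$-free $r$-graph on $n$ vertices. A subgraph of an $r$-graph $\mathcal{H}$ is ''contained in'' $\mathcal{H}$ if it is isomorphic to a subgraph of $\mathcal{H}$. Transversal number: for a $3$-graph $\mathcal{H}$, $\tau(\mathcal{H})$ is the minimum size of a vertex set meeting every edge of $\mathcal{H}$ ($\tau=0$ if $\mathcal{H}$ has no edges). For $\ell \ge 3$, $\mathcal{K}^3_{\ell+1}$ is the collection of all $3$-graphs $F$ on at most $(\ell+1)+\binom{\ell+1}{2}$ vertices such that for some $(\ell+1)$-set $S\subseteq V(F)$ (called a core of $F$) every pair $\{u,v\}\subseteq S$ is contained in some edge of $F$. Blowup: if $\mathcal{T}$ is a $3$-graph on vertex set $[s]$ and $t=(t_1,\dots,t_s)$ are positive integers, the blowup $\mathcal{T}(t)$ is obtained by replacing each vertex $i$ by a set of size $t_i$ (the sets pairwise disjoint) and each edge of $\mathcal{T}$ by the complete $3$-partite $3$-graph on the corresponding three sets. $\mathcal{G}^1_n$: take disjoint sets $A,B$ with $|A|=\lfloor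 n/3\rfloor$, $|B|=\lceil 2n/3\rceil$; $\mathcal{G}^1_n=\{\{a,b,b'\}: a\in A,\ \{b,b'\}\subseteq B\}$. $\mathcal{G}^2_6$ is the $3$-graph on $[6]$ whose edge set is all $3$-subsets of $[6]$ except $\{1,2,3\},\{1,2,6\},\{3,4,5\},\{4,5,6\}$. For $n>6$, $\mathcal{G}^2_n$ is a blowup of $\mathcal{G}^2_6$ on $n$ vertices with the maximum number of edges. $\mathcal{M}=M_1\cup M_2\cup M_3$, where: $M_1=\{K_5^{3-}\}$, $K_5^{3-}$ being the complete $3$-graph on five vertices with one edge removed; $M_2$ is the set of all $F\in\mathcal{K}^3_7$ having a core $S$ such that the induced subgraph $F[S]$ satisfies $\tau(F[S])\ge 2$; $M_3$ is the set of all $F\in\mathcal{K}^3_6$ such that $F$ is not contained in $\mathcal{G}^1_n$ for any positive integer $n$ and $F$ is not contained in $\mathcal{G}^2_n$ for any $n\ge 6$. *)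

(* Defs.v *)
From mathcomp Require Import all_boot.
Set Implicit Arguments. Unset Strict Implicit. Unset Printing Implicit Defensive.

Definition is3graph (T : finType) (H : {set {set T}}) : Prop :=
  forall e, e \in H -> #|e| = 3.

Definition contained (m : nat) (T : finType) (F : {set {set 'I_m}}) (H : {set {set T}}) : Prop :=
  exists f : 'I_m -> T, injective f /\ forall e, e \in F -> f @: e \in H.

Definition hiso (m k : nat) (F : {set {set 'I_m}}) (G : {set {set 'I_k}}) : Prop :=
  exists f : 'I_m -> 'I_k, bijective f /\ forall e, (e \in F) = (f @: e \in G).

Definition coverb (T : finType) (H : {set {set T}}) (C : {set T}) : bool :=
  [forall e in H, C :&: e != set0].
Definition tau (T : finType) (H : {set {set T}}) : nat :=
  #|[arg min_(C < [set: T] | coverb H C) #|C| ]|.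

Definition induced (T : finType) (H : {set {set T}}) (S : {set T}) : {set {set T}} :=
  [set e in H | e \subset S].

Definition is_core (l : nat) (T : finType) (F : {set {set T}}) (S : {set T}) : Prop :=
  #|S| = l.+1 /\
  forall u v, u \in S -> v \in S -> u != v -> exists2 e, e \in F & (u \in e) && (v \in e).

Definition inK (l m : nat) (F : {set {set 'I_m}}) : Prop :=
  is3graph F /\ m <= l.+1 + 'C(l.+1, 2) /\ exists S, is_core l F S.

Definition K5minus : {set {set 'I_5}} :=
  [set e : {set 'I_5} | (#|e| == 3) && (e != [set inord 0; inord 1; inord 2])].

Definition G1 (n : nat) : {set {set 'I_n}} :=
  [set e : {set 'I_n} | (#|e| == 3) &&
     (#|[set x in e | x < n %/ 3]| == 1)].

(* G^2_6 on 'I_6 (vertex i of the paper is inord (i-1)) *)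
Definition G26 : {set {set 'I_6}} :=
  [set e : {set 'I_6} | (#|e| == 3) &&
     (e \notin [:: [set inord 0; inord 1; inord 2]; [set inord 0; inord 1; inord 5];
                  [set inord 2; inord 3; inord 4]; [set inord 3; inord 4; inord 5]])].

(* blowup of G^2_6 along a map f (parts f^-1(i)) *)
Definition blowup26 (n : nat) (f : 'I_n -> 'I_6) : {set {set 'I_n}} :=
  [set e : {set 'I_n} | [&& #|e| == 3, #|f @: e| == 3 & f @: e \in G26]].

Definition isG2 (n : nat) (H : {set {set 'I_n}}) : Prop :=
  exists f : 'I_n -> 'I_6, (forall i, exists x, f x = i) /\ H = blowup26 f /\
    forall g : 'I_n -> 'I_6, (forall i, exists x, g x = i) ->
      #|blowup26 g| <= #|blowup26 f|.

Definition inM1 (m : nat) (F : {set {set 'I_m}}) : Prop := hiso F K5minus.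

Definition inM2 (m : nat) (F : {set {set 'I_m}}) : Prop :=
  @inK 6 m F /\ exists S, is_core 6 F S /\ 2 <= tau (induced F S).

Definition inM3 (m : nat) (F : {set {set 'I_m}}) : Prop :=
  @inK 5 m F /\
  (forall n, 0 < n -> ~ contained F (G1 n)) /\
  (forall n (H : {set {set 'I_n}}), 6 <= n -> isG2 H -> ~ contained F H).

Definition inM (m : nat) (F : {set {set 'I_m}}) : Prop :=
  inM1 F \/ inM2 F \/ inM3 F.

Definition Mfree (T : finType) (H : {set {set T}}) : Prop :=
  forall m (F : {set {set 'I_m}}), inM F -> ~ contained F H.

(* Main.v *)
From Stdlib Require Import ZArith.
Require Import Defs.
From mathcomp Require Import all_boot zify.

Set Implicit Arguments. Unset Strict Implicit. Unset Printing Implicit Defensive.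

(** Give the vertices natural weights [x] and let [weight H x] be the sum over
    the edges of the products of their weights; the upper bound is the claim
    [27 weight H x <= 2 (sum x)^3] at [x = 1].  If two vertices of the support lie
    in no common edge inside the support, then [weight H] is affine when weight is
    moved between them, so one of them can be discarded.  Hence we may assume that
    every pair in the support [S] is covered by an edge inside [S].
    - If [S] has at least 7 vertices, every 7-subset is a core, so [M2]-freeness
      makes the edges inside it a star; this forces all edges inside [S] to form a
      star, and the bound is AM-GM.
    - If [S] has 6 vertices, [M3]-freeness maps [H] homomorphically into the
      pattern of [G1] or into [G26].
    - If [S] has at most 5 vertices, [M1]-freeness maps it into [G26].
    With weight [s] on the vertices 1, 2, 4, 5 (numbered as in the paper) and [c] on
    3, 6, the weight of [G26] is at
    most [s (s + 2 c)^2 / 16], which is at most [2/27 (s + c)^3].  Equality holds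
    for the balanced blowup, so it is a [G2] graph and [M3]-free; any 7-core
    would embed into 6 vertices, and [G26] does not contain [K5minus]. *)

(** * Weighted edge sums over ordered triples *)

Definition weight (T : finType) (H : {set {set T}}) (x : T -> nat) : nat :=
  \sum_(e in H) \prod_(i in e) x i.

Lemma cards3P (T : finType) (e : {set T}) :
  #|e| = 3 -> exists a b c, uniq [:: a; b; c] /\ e = [set a; b; c].
Proof.
move=> e3; move: (enum_uniq e) (cardE e); rewrite e3.
case Ee: (enum e) => [|a [|b [|c [|d s]]]] //= Hu _; exists a, b, c; split=> //.
by apply/setP=> x; rewrite -mem_enum Ee !inE orbA.
Qed.

Lemma card_set3 (T : finType) (a b c : T) :
  (#|[set a; b; c]| == 3) = uniq [:: a; b; c].
Proof.
have -> : [set a; b; c] = [set:: [:: a; b; c]].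
  by apply/setP=> x; rewrite !inE orbA.
by rewrite cardsE; apply/eqP/idP=> [/card_uniqP|/card_uniqP].
Qed.

Lemma eq_set3 (T : finType) (a b c : T) (D : {set T}) :
  uniq [:: a; b; c] -> #|D| = 3 ->
  ([set a; b; c] == D) = all (mem D) [:: a; b; c].
Proof.
rewrite -card_set3 => /eqP c3 D3.
by rewrite eqEcard c3 D3 leqnn andbT !subUset !sub1set /= andbT andbA.
Qed.

Lemma sum_ordered_triples (T : finType) (x : T -> nat) (e : {set T}) :
  #|e| = 3 ->
  \sum_(t : T * T * T | [set t.1.1; t.1.2; t.2] == e)
     x t.1.1 * x t.1.2 * x t.2 = 6 * \prod_(i in e) x i.
Proof.
move=> e3; have [a [b [c [Hu De]]]] := cards3P e3.
pose s := [:: (a, b, c); (a, c, b); (b, a, c); (b, c, a); (c, a, b); (c, b, a)].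
move: (Hu); rewrite /= !inE negb_or andbT => /andP[/andP[nab nac] nbc].
have us : uniq s.
  rewrite /s /= !inE !xpair_eqE !eqxx (negPf nab) (negPf nac) (negPf nbc).
  by rewrite (eq_sym b a) (eq_sym c a) (eq_sym c b) (negPf nab) (negPf nac) (negPf nbc).
rewrite (eq_bigl (fun t => t \in s)); last first.
  move=> [[i j] k] /=; apply/idP/idP=> [/eqP E|].
    have Hijk : uniq [:: i; j; k] by rewrite -card_set3 E e3.
    have := E; rewrite De => E'.
    have : i \in [set a; b; c] by rewrite -E' !inE eqxx.
    have : j \in [set a; b; c] by rewrite -E' !inE eqxx ?orbT.
    have : k \in [set a; b; c] by rewrite -E' !inE eqxx ?orbT.
    rewrite !inE -!orbA => /or3P[] /eqP ? /or3P[] /eqP ? /or3P[] /eqP ?; subst;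
    by move: Hijk; rewrite /= !inE !eqxx ?orbT ?andbF // => _; rewrite !xpair_eqE !eqxx ?orbT.
  move=> Hs; rewrite De eq_set3; last by rewrite -De.
    move: Hs; rewrite !inE !xpair_eqE -!andbA.
    by case/or4P=> [|||/or3P[]] /and3P[/eqP-> /eqP-> /eqP->]; rewrite /= !inE !eqxx ?orbT.
  move: Hs; rewrite !inE !xpair_eqE -!andbA.
  case/or4P=> [|||/or3P[]] /and3P[/eqP-> /eqP-> /eqP->]; rewrite /= !inE;
  by rewrite ?(eq_sym b a) ?(eq_sym c a) ?(eq_sym c b) (negPf nab) (negPf nac) (negPf nbc).

rewrite -big_uniq //= /s !big_cons big_nil /=.
have -> : \prod_(i in e) x i = x a * x b * x c.
  rewrite (eq_bigl (fun i => i \in [:: a; b; c])); last by move=> i; rewrite De !inE orbA.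
  by rewrite -big_uniq //= !big_cons big_nil /=; lia.
lia.
Qed.

(** Each edge has six orderings. The nested sum over ordered triples, unlike the sum over edges, can
    be regrouped along the fibres of a vertex map. *)
Lemma weight_triples (T : finType) (H : {set {set T}}) (x : T -> nat) :
  is3graph H ->
  6 * weight H x =
  \sum_i \sum_j \sum_(k | [set i; j; k] \in H) x i * x j * x k.
Proof.
move=> H3; rewrite pair_big pair_big_dep /= /weight big_distrr /=.
rewrite (partition_big (fun t : T * T * T => [set t.1.1; t.1.2; t.2]) (mem H)) //=.
apply: eq_bigr => e He; rewrite -(sum_ordered_triples x (H3 _ He)).
by apply: eq_bigl => t; case: eqP => [->|]; rewrite ?andbF // andbT; apply/esym.
Qed.

(** * Pushing weights forward to a pattern *)

Section Pattern.
Variables (T C : finType) (phi : T -> C) (P : C -> C -> C -> bool) (x : T -> nat).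

Definition pushforward (c : C) := \sum_(i | phi i == c) x i.
Local Notation y := pushforward.

Lemma sum_pushforward : \sum_c y c = \sum_i x i.
Proof. by rewrite [RHS](partition_big phi predT). Qed.

Lemma pattern_pushforward :
  \sum_i \sum_j \sum_(k | P (phi i) (phi j) (phi k)) x i * x j * x k =
  \sum_p \sum_q \sum_(r | P p q r) y p * y q * y r.
Proof.
rewrite (partition_big phi predT) //=; apply: eq_bigr => p _.
under eq_bigr => i /eqP-> do rewrite (partition_big phi predT) //=.
rewrite exchange_big /=; apply: eq_bigr => q _.
under eq_bigr => i _ do under eq_bigr => j /eqP-> do
  rewrite (partition_big phi (P p q)) //=.
under eq_bigr => i _ do rewrite exchange_big /=.
rewrite exchange_big /=; apply: eq_bigr => r Pr.
rewrite /pushforward big_distrlr /= big_distrl /=; apply: eq_bigr => i _.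
rewrite big_distrlr /=; apply: eq_bigr => j _.
apply: eq_bigl => k; case: eqP => [->|]; by rewrite ?Pr ?andbF.
Qed.

(** Triples of weight zero contribute nothing, so the map has to respect the pattern only on edges
    inside the support. *)
Lemma weight_pattern_le (H : {set {set T}}) :
  is3graph H ->
  (forall i j k, [set i; j; k] \in H -> 0 < x i * x j * x k ->
     P (phi i) (phi j) (phi k)) ->
  6 * weight H x <= \sum_p \sum_q \sum_(r | P p q r) y p * y q * y r.
Proof.
move=> H3 HP; rewrite weight_triples // -pattern_pushforward.
apply: leq_sum => i _; apply: leq_sum => j _.
rewrite big_mkcond [leqRHS]big_mkcond; apply: leq_sum => k _.
case: ifP => // Hijk; case: ifP => // nP.
by rewrite leqNgt; apply/negP => /(HP _ _ _ Hijk); rewrite nP.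
Qed.

Lemma weight_pattern_eq (H : {set {set T}}) :
  is3graph H ->
  (forall i j k, ([set i; j; k] \in H) = P (phi i) (phi j) (phi k)) ->
  6 * weight H x = \sum_p \sum_q \sum_(r | P p q r) y p * y q * y r.
Proof.
move=> H3 HP; rewrite weight_triples // -pattern_pushforward.
by do 2!(apply: eq_bigr => ? _); apply: eq_bigl.
Qed.

End Pattern.

(** * Polynomial bounds for the two extremal patterns *)

Lemma cube_bound_G1 a b : 27 * (3 * (a * b * b)) <= 12 * (a + b) ^ 3.
Proof.
(* [4 (a + b)^3 - 27 a b^2 = (2 a - b)^2 (a + 4 b)] *)
have : (0 <= (2 * Z.of_nat a - Z.of_nat b) * (2 * Z.of_nat a - Z.of_nat b)
         * (Z.of_nat a + 4 * Z.of_nat b))%Z.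
  by apply: Z.mul_nonneg_nonneg; [exact: Z.square_nonneg|lia].
rewrite !expnS expn0; nia.
Qed.

(** This is the pattern of [G1]. With weight a in [A] and b outside, the ordered triples contribute
    at most 3 a b^2, one term for each position of the vertex in [A]. *)
Lemma weight_cross_le (T : finType) (H : {set {set T}}) (A : pred T) (x : T -> nat) :
  is3graph H ->
  (forall i j k, [set i; j; k] \in H -> 0 < x i * x j * x k ->
     A i + A j + A k = 1) ->
  27 * weight H x <= 2 * (\sum_i x i) ^ 3.
Proof.
move=> H3 HA.
have /(_ H3) := @weight_pattern_le T bool A (fun p q r => p + q + r == 1) x H.
have HP i j k : [set i; j; k] \in H -> 0 < x i * x j * x k -> A i + A j + A k == 1.
  by move=> Hijk x0; rewrite (HA _ _ _ Hijk x0).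
move=> /(_ HP).
rewrite -(sum_pushforward A x).
move: (pushforward A x) => y.
rewrite !big_bool !(big_mkcond (fun r => _ == _)) !big_bool /=.
have := cube_bound_G1 (y true) (y false). lia.
Qed.

(** The edge relation of [G26] on ordered triples, stated on naturals so that finite checks reduce
    by computation. *)
Definition g26 (p q r : nat) : bool :=
  uniq [:: p; q; r] &&
  all (fun D => ~~ all (mem D) [:: p; q; r])
    [:: [:: 0; 1; 2]; [:: 0; 1; 5]; [:: 2; 3; 4]; [:: 3; 4; 5]].

Lemma in_G26 (p q r : 'I_6) : ([set p; q; r] \in G26) = g26 p q r.
Proof.
rewrite inE card_set3 /g26.
have -> : uniq [:: (p : nat); (q : nat); (r : nat)] = uniq [:: p; q; r] by [].
case Hu: (uniq _) => //=.
have E (a b c : nat) : a < 6 -> b < 6 -> c < 6 -> uniq [:: a; b; c] ->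
  ([set p; q; r] == [set inord a; inord b; inord c]) =
  all (mem [:: a; b; c]) [:: (p : nat); (q : nat); (r : nat)].
  move=> ha hb hc habc; rewrite eq_set3 //=.
    by rewrite !inE -!val_eqE /= !inordK // !orbA.
  by apply/eqP; rewrite card_set3 /= !inE -!val_eqE /= !inordK; move: habc; rewrite /= !inE.
by rewrite 4!inE !E //= !negb_or !andbT.
Qed.

(** Split the vertices into the pairs {0,1}, {3,4} and {2,5}. The non-edges are {0,1} or {3,4}
    together with a vertex of {2,5}. The first term counts the transversals of the three pairs, the
    others the edges containing a whole pair. *)
Lemma sum_g26 (y : nat -> nat) :
  \sum_(p < 6) \sum_(q < 6) \sum_(r < 6 | g26 p q r) y p * y q * y r =
  6 * ((y 0 + y 1) * (y 3 + y 4) * (y 2 + y 5) + y 0 * y 1 * (y 3 + y 4)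
       + y 3 * y 4 * (y 0 + y 1) + y 2 * y 5 * (y 0 + y 1 + (y 3 + y 4))).
Proof.
pose t p q r := if g26 p q r then y p * y q * y r else 0.
under eq_bigr => p _ do under eq_bigr => q _ do rewrite big_mkcond /=.
rewrite -(big_mkord predT (fun p => \sum_(q < 6) \sum_(r < 6) t p q r)).
under eq_bigr => p _ do rewrite -(big_mkord predT (fun q => \sum_(r < 6) t p q r)).
under eq_bigr => p _ do under eq_bigr => q _ do rewrite -(big_mkord predT (t p q)).
(* Unlocking the big operators lets [g26] compute, which leaves an explicit polynomial identity. *)
rewrite unlock /t /=; lia.
Qed.

Lemma sum_g26_le (y : nat -> nat) :
  27 * \sum_(p < 6) \sum_(q < 6) \sum_(r < 6 | g26 p q r) y p * y q * y r
  <= 12 * (\sum_(p < 6) y p) ^ 3.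
Proof.
have -> : \sum_(p < 6) y p = y 0 + y 1 + y 2 + y 3 + y 4 + y 5.
  by rewrite !big_ord_recr big_ord0.
rewrite sum_g26.
move: (y 0) (y 1) (y 2) (y 3) (y 4) (y 5) => a1 a2 c1 b1 b2 c2.
have sq u v : 4 * (u * v) <= (u + v) * (u + v) by rewrite mulnn; exact: (nat_AGM2 u v).
pose a := a1 + a2; pose b := b1 + b2; pose c := c1 + c2; pose s := a + b.
(* AM-GM inside each of the three pairs. *)
have h1 : 16 * ((a1 + a2) * (b1 + b2) * (c1 + c2) + a1 * a2 * (b1 + b2)
       + b1 * b2 * (a1 + a2) + c1 * c2 * (a1 + a2 + (b1 + b2))) <=
     16 * (a * b * c) + 4 * (a * b * s) + 4 * (c * c * s).
  rewrite -/a -/b -/c.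
  have := leq_mul (sq a1 a2) (leqnn b); have := leq_mul (sq b1 b2) (leqnn a).
  have := leq_mul (sq c1 c2) (leqnn s); rewrite -/a -/b -/c /s; clearbody a b c; nia.
(* AM-GM between a and b: 4 a b <= s^2, multiplied by 4 c + s. *)
have h2 : 16 * (a * b * c) + 4 * (a * b * s) + 4 * (c * c * s) <=
   s * (s + 2 * c) * (s + 2 * c).
  have := leq_mul (sq a b) (leqnn (4 * c + s)); rewrite -/s; clearbody s; nia.
have h3 : 27 * (s * (s + 2 * c) * (s + 2 * c)) <= 32 * (s + c) ^ 3.
  (* the difference is [(s - 2 c)^2 (5 s + 8 c)] *)
  have : (0 <= (Z.of_nat s - 2 * Z.of_nat c) * (Z.of_nat s - 2 * Z.of_nat c)
         * (5 * Z.of_nat s + 8 * Z.of_nat c))%Z.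
    by apply: Z.mul_nonneg_nonneg; [exact: Z.square_nonneg|lia].
  rewrite !expnS expn0; clearbody s c; nia.
have -> : a1 + a2 + c1 + b1 + b2 + c2 = s + c by rewrite /s /a /b /c; lia.
move: h1 h2 h3; set X := _ + c1 * c2 * _; set Y := (s + c) ^ 3.
clearbody X Y; lia.
Qed.

Lemma weight_hom_G26_le (T : finType) (H : {set {set T}}) (phi : T -> 'I_6)
    (x : T -> nat) :
  is3graph H ->
  (forall i j k, [set i; j; k] \in H -> 0 < x i * x j * x k ->
     g26 (phi i) (phi j) (phi k)) ->
  27 * weight H x <= 2 * (\sum_i x i) ^ 3.
Proof.
move=> H3 HP; have := weight_pattern_le (P := fun p q r : 'I_6 => g26 p q r) H3 HP.
rewrite -(sum_pushforward phi x); move: (pushforward phi x) => y.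
have := sum_g26_le (fun p => y (inord p)).
have -> : \sum_(p < 6) y (inord p) = \sum_p y p.
  by apply: eq_bigr => p _; rewrite inord_val.
have -> : \sum_(p < 6) \sum_(q < 6) \sum_(r < 6 | g26 p q r)
    y (inord p) * y (inord q) * y (inord r) =
    \sum_(p < 6) \sum_(q < 6) \sum_(r < 6 | g26 p q r) y p * y q * y r.
  by do 3!(apply: eq_bigr => ? _); rewrite !inord_val.
by move=> h1 h2; have := leq_trans (leq_mul (leqnn 27) h2) h1; lia.
Qed.

(** * Blowups of [G26] *)

Lemma blowup26_is3graph n (f : 'I_n -> 'I_6) : is3graph (blowup26 f).
Proof. by move=> e; rewrite inE => /and3P[/eqP]. Qed.

Lemma in_blowup26 n (f : 'I_n -> 'I_6) i j k :
  ([set i; j; k] \in blowup26 f) = g26 (f i) (f j) (f k).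
Proof.
rewrite inE !imsetU !imset_set1 in_G26.
case G: (g26 _ _ _); rewrite ?andbF ?andbT //.
have Hf : #|[set f i; f j; f k]| == 3.
  by rewrite card_set3; case/andP: G.
(* Three distinct images force three distinct vertices, so [g26] already implies the size condition
   on the edge. *)
rewrite Hf andbT eqn_leq; apply/andP; split.
  by rewrite (leq_trans (leq_card_setU _ _)) // cards1 addn1 ltnS cards2; case: (_ != _).
rewrite -(eqP Hf); have -> : [set f i; f j; f k] = f @: [set i; j; k].
  by rewrite !imsetU !imset_set1.
exact: leq_imset_card.
Qed.

Lemma weight1 (T : finType) (H : {set {set T}}) : weight H (fun=> 1) = #|H|.
Proof.
rewrite -sum1_card; apply: eq_bigr => e _; exact: big1_eq.
Qed.

Lemma card_blowup26_le n (f : 'I_n -> 'I_6) : 27 * #|blowup26 f| <= 2 * n ^ 3.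
Proof.
have := @weight_hom_G26_le _ _ f (fun=> 1) (@blowup26_is3graph n f).
rewrite weight1 sum1_card card_ord; apply=> i j k; by rewrite in_blowup26.
Qed.

(** * Symmetrization *)

(* Moving the whole weight of [u] to [v] or conversely: [weight H] is affine
   along this segment when no edge of positive weight contains both. *)
Lemma weight_shift (T : finType) (H : {set {set T}}) (x : T -> nat) (u v : T) :
  u != v ->
  (forall e, e \in H -> u \in e -> v \in e -> exists2 i, i \in e & x i = 0) ->
  0 < x u -> 0 < x v ->
  x u * weight H (fun i => if i == v then 0 else if i == u then x u + x v else x i) +
  x v * weight H (fun i => if i == u then 0 else if i == v then x u + x v else x i)
  = (x u + x v) * weight H x.
Proof.
move=> nuv Huv xu xv; rewrite /weight !big_distrr -big_split /=.
apply: eq_bigr => e He.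
have prod0 (g : T -> nat) i : i \in e -> g i = 0 -> \prod_(j in e) g j = 0.
  by move=> ie gi; rewrite (bigD1 i) //= gi.
case ue: (u \in e); case ve: (v \in e).
- have [i ie xi] := Huv _ He ue ve.
  have niu : i != u by apply: contraTneq xu => <-; rewrite xi.
  have niv : i != v by apply: contraTneq xv => <-; rewrite xi.
  by rewrite !(prod0 _ i) ?(negPf niu) ?(negPf niv) // !muln0.
- rewrite [X in _ + _ * X](prod0 _ u) ?eqxx // muln0 addn0.
  rewrite !(bigD1 u ue) /= eqxx (negPf nuv).
  rewrite (eq_bigr x); first by lia.
  move=> i /andP[ie /negPf->]; case: eqP => // iv; by case/negP: (negbT ve); rewrite -iv.
- rewrite [X in _ * X + _](prod0 _ v) ?eqxx // muln0 add0n.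
  rewrite !(bigD1 v ve) /= eqxx eq_sym (negPf nuv).
  rewrite (eq_bigr x); first by lia.
  move=> i /andP[ie /negPf->]; case: eqP => // iv; by case/negP: (negbT ue); rewrite -iv.
- have avoid i : i \in e -> (i == u = false) * (i == v = false).
    by move=> ie; split; apply: contraTF ie => /eqP->; rewrite ?ue ?ve.
  rewrite mulnDl; congr (_ * _ + _ * _).
    by apply: eq_bigr => i /avoid E; rewrite !E.
  by apply: eq_bigr => i /avoid E; rewrite !E.
Qed.

Lemma sum_shift (T : finType) (x : T -> nat) (u v : T) :
  u != v ->
  \sum_i (if i == v then 0 else if i == u then x u + x v else x i) = \sum_i x i.
Proof.
move=> nuv; rewrite (bigD1 v) // (bigD1 u) //= !eqxx (negPf nuv).
rewrite [RHS](bigD1 v) // [in RHS](bigD1 u) //=.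
rewrite (eq_bigr x); first by lia.
by move=> i /andP[/negPf-> /negPf->].
Qed.

Definition covers_pairs (T : finType) (H : {set {set T}}) (S : {set T}) : Prop :=
  forall u v, u \in S -> v \in S -> u != v ->
    exists2 e, e \in H & [&& e \subset S, u \in e & v \in e].

(** Induction on the size of the support. For an uncovered pair [u], [v], the weight of [H] is the
    average, with coefficients [x u] and [x v], of its values after the two shifts. Both shifts keep
    the total and shrink the support, so their bounds average to the bound for [x]. Only whole
    weights move, hence natural weights suffice. *)
Lemma weight_le_of_2covered (T : finType) (H : {set {set T}}) :
  (forall x, covers_pairs H [set i | 0 < x i] ->
     27 * weight H x <= 2 * (\sum_i x i) ^ 3) ->
  forall x, 27 * weight H x <= 2 * (\sum_i x i) ^ 3.
Proof.
move=> Hcov x.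
have [m] := ubnP #|[set i | 0 < x i]|; elim: m x => // m IH x lem.
set S := [set i | 0 < x i] in lem.
case: (boolP [forall u in S, forall v in S, (u != v) ==>
   [exists e in H, [&& e \subset S, u \in e & v \in e]]]) => [/forall_inP cov|].
  apply: Hcov => u v uS vS nuv.
  by have /forall_inP/(_ v vS)/implyP/(_ nuv)/exists_inP[e He ?] := cov u uS; exists e.
case/forall_inPn=> u uS /forall_inPn[v vS]; rewrite negb_imply => /andP[nuv nex].
have xu : 0 < x u by rewrite inE in uS.
have xv : 0 < x v by rewrite inE in vS.
have Huv e : e \in H -> u \in e -> v \in e -> exists2 i, i \in e & x i = 0.
  move=> He ue ve; have /subsetPn[i ie] : ~~ (e \subset S).
    by apply: contra nex => eS; apply/exists_inP; exists e; rewrite ?eS ?ue.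
  by rewrite inE -eqn0Ngt => /eqP; exists i.
have lt_supp (y : T -> nat) w : w \in S -> y w = 0 ->
    (forall i, 0 < y i -> i \in S) -> #|[set i | 0 < y i]| < m.
  move=> wS yw yS; rewrite ltnS in lem; apply: leq_trans lem; apply: proper_card.
  apply/properP; split; first by apply/subsetP=> i; rewrite inE; apply: yS.
  by exists w; rewrite // inE yw.
have := weight_shift nuv Huv xu xv.
have := sum_shift x nuv.
have : v != u by rewrite eq_sym.
move/(sum_shift x); rewrite [x v + x u]addnC.
set y := (fun i => if i == v then _ else _); set z := (fun i => if i == u then _ else _).
move=> Sz Sy E.
have := IH y (lt_supp y v vS _ _); rewrite Sy => /(_ _ _) Hy.
have := IH z (lt_supp z u uS _ _); rewrite Sz => /(_ _ _) Hz.
have {}Hy : 27 * weight H y <= 2 * (\sum_i x i) ^ 3.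
  apply: Hy; rewrite /y ?eqxx // => i.
  by case: eqP => // _; case: eqP => [->|]; rewrite // inE.
have {}Hz : 27 * weight H z <= 2 * (\sum_i x i) ^ 3.
  apply: Hz; rewrite /z ?eqxx // => i.
  by case: eqP => // _; case: eqP => [->|]; rewrite // inE.
have x0 : 0 < x u + x v by rewrite addn_gt0 xu.
rewrite -(leq_pmul2l x0) mulnCA -E mulnDr [27 * (_ * _)]mulnCA.
by rewrite [27 * (x v * _)]mulnCA mulnDl leq_add ?leq_mul2l ?Hy ?Hz ?orbT.
Qed.

(** * Transversals, traces and hulls of cores *)

(** A cover with at most one vertex lies in some [[set w]] and misses an edge avoiding [w]; [t0]
    provides [w] when the cover is empty. *)
Lemma tau_ge2 (T : finType) (G : {set {set T}}) (t0 : T) :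
  is3graph G -> (forall w, exists2 e, e \in G & w \notin e) -> 2 <= tau G.
Proof.
move=> G3 Gw; rewrite /tau; case: arg_minnP => [|C covC _].
  by apply/forall_inP=> e /G3 e3; rewrite setTI -card_gt0 e3.
rewrite ltnNge; apply/negP => C1.
have [w Cw] : exists w, C \subset [set w].
  case: (set_0Vmem C) => [->|[w wC]]; first by exists t0; rewrite sub0set.
  exists w; have : [set w] == C by rewrite eqEcard sub1set wC cards1.
  by move/eqP->.
have [e eG we] := Gw w; have /set0Pn[i] := forall_inP covC e eG.
by rewrite inE => /andP[/(subsetP Cw)]; rewrite inE => /eqP->; apply/negP.
Qed.

(** The subgraph induced on [W], relabelled by ordinals because the members of the forbidden family
    live on some ['I_m]. *)
Definition trace (T : finType) (H : {set {set T}}) (W : {set T}) :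
    {set {set 'I_#|W|}} := [set e : {set 'I_#|W|} | enum_val @: e \in H].

Section Trace.
Variables (T : finType) (H : {set {set T}}) (W : {set T}).
Hypothesis H3 : is3graph H.

Lemma trace_contained : contained (trace H W) H.
Proof. by exists enum_val; split=> [|e]; [exact: enum_val_inj|rewrite inE]. Qed.

Lemma trace_is3graph : is3graph (trace H W).
Proof. by move=> e; rewrite inE => /H3; rewrite card_imset //; exact: enum_val_inj. Qed.

Lemma imset_preim_enum_val (e : {set T}) :
  e \subset W -> @enum_val _ (mem W) @: (enum_val @^-1: e) = e.
Proof.
move=> eW; apply/setP=> i; apply/imsetP/idP=> [[j]|ie].
  by rewrite inE => ? ->.
have iW := subsetP eW _ ie.
by exists (enum_rank_in iW i); rewrite ?inE enum_rankK_in.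
Qed.

Lemma preim_in_trace (e : {set T}) :
  e \in H -> e \subset W -> enum_val @^-1: e \in trace H W.
Proof. by move=> eH eW; rewrite inE imset_preim_enum_val. Qed.

Lemma trace_is_core l (S : {set T}) :
  S \subset W -> #|S| = l.+1 ->
  (forall u v, u \in S -> v \in S -> u != v ->
     exists2 e, e \in H & [&& e \subset W, u \in e & v \in e]) ->
  is_core l (trace H W) (enum_val @^-1: S).
Proof.
move=> SW Sl cov; split.
  by rewrite -(card_imset _ (@enum_val_inj _ (mem W))) imset_preim_enum_val.
move=> u v; rewrite !inE => uS vS nuv.
have [|e eH /and3P[eW ue ve]] := cov _ _ uS vS; first by rewrite (inj_eq enum_val_inj).
by exists (enum_val @^-1: e); [exact: preim_in_trace|rewrite !inE ue].
Qed.

End Trace.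

Lemma leq_card_bigcup (I T : finType) (P : pred I) (F : I -> {set T}) :
  #|\bigcup_(i | P i) F i| <= \sum_(i | P i) #|F i|.
Proof.
elim/big_rec2: _ => [|i n A _ le]; first by rewrite cards0.
by rewrite (leq_trans (leq_card_setU _ _)) // leq_add2l.
Qed.

(* One extra vertex per pair of the core is enough to keep all pairs covered,
   whence the vertex bound in the definition of [inK]. *)
Lemma core_hull (T : finType) (H : {set {set T}}) l (S : {set T}) :
  is3graph H -> is_core l H S ->
  exists W : {set T}, [/\ S \subset W, #|W| <= l.+1 + 'C(l.+1, 2) &
    forall u v, u \in S -> v \in S -> u != v ->
     exists2 e, e \in H & [&& e \subset W, u \in e & v \in e]].
Proof.
move=> H3 [Sl cov].
(* The default [set0] makes a pair without a covering edge add no vertex to [W]. *)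
pose ed (P : {set T}) := odflt set0 [pick e in H | P \subset e].
pose W := S :|: \bigcup_(P : {set T} | (P \subset S) && (#|P| == 2)) (ed P :\: P).
exists W; split; first exact: subsetUl.
  rewrite (leq_trans (leq_card_setU _ _)) // Sl leq_add2l.
  rewrite (leq_trans (leq_card_bigcup _ _)) //.
  have <- : #|[set P : {set T} | P \subset S & #|P| == 2]| = 'C(l.+1, 2).
    by rewrite cards_draws Sl.
  rewrite -sum1_card [leqRHS](eq_bigl (fun P : {set T} => (P \subset S) && (#|P| == 2))).
    apply: leq_sum => P /andP[_ /eqP P2]; rewrite /ed.
    case: pickP => [e /andP[/H3 e3 Pe]|_] /=; last by rewrite set0D cards0.
    by rewrite cardsD (setIidPr Pe) e3 P2.
  by move=> P; rewrite inE.
move=> u v uS vS nuv.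
have PS : [set u; v] \subset S by rewrite subUset !sub1set uS.
have [e0 e0H /andP[ue0 ve0]] := cov _ _ uS vS nuv.
have : exists2 e, e \in H & ed [set u; v] = e /\ [set u; v] \subset e.
  rewrite /ed; case: pickP => [e /andP[eH Pe]|/(_ e0)]; first by exists e.
  by rewrite e0H subUset !sub1set ue0 ve0.
case=> e eH [ede Pe]; exists e => //.
have [ue ve] : u \in e /\ v \in e.
  by move: Pe; rewrite subUset !sub1set => /andP[].
rewrite ue ve !andbT; apply/subsetP=> i ie; rewrite inE.
case: (boolP (i \in [set u; v])) => [/(subsetP PS)->//|iP].
apply/orP; right; apply/bigcupP; exists [set u; v]; first by rewrite PS cards2 nuv.
by rewrite inE iP ede.
Qed.

(** * Stars forced by cores of seven vertices *)

(** Otherwise every vertex is missed by an edge inside [S], and the trace of [H] on a hull of [S]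
    belongs to [M2]. *)
Lemma Mfree_core7_star (T : finType) (H : {set {set T}}) (S : {set T}) :
  is3graph H -> Mfree H -> is_core 6 H S ->
  exists w, forall e, e \in H -> e \subset S -> w \in e.
Proof.
move=> H3 HM coreS.
have S7 : #|S| = 7 by case: coreS.
have [W [SW Wle cov]] := core_hull H3 coreS.
have coreF := trace_is_core SW S7 cov.
case: (boolP [exists w, [forall e in H, (e \subset S) ==> (w \in e)]]).
  case/existsP=> w /forall_inP Hw; exists w => e eH eS.
  by move/implyP: (Hw e eH); apply.
move=> /existsPn nw; case: (HM _ (trace H W)); last exact: trace_contained.
right; left; split; first by split; [exact: trace_is3graph|split=> //; eexists; exact: coreF].
eexists; split; first exact: coreF.
have /card_gt0P[t0 t0S] : 0 < #|S| by rewrite S7.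
apply: (tau_ge2 (enum_rank_in (subsetP SW _ t0S) t0)) => [e|w].
  by rewrite inE => /andP[/(trace_is3graph H3)].
have /forall_inPn[e eH] := nw (enum_val w); rewrite negb_imply => /andP[eS we].
exists (enum_val @^-1: e); last by rewrite inE.
rewrite inE preim_in_trace ?(subset_trans eS) //=.
by apply/subsetP=> i; rewrite !inE => /(subsetP eS).
Qed.

Lemma exists_set_between (T : finType) (A B : {set T}) k :
  A \subset B -> #|A| <= k <= #|B| ->
  exists C : {set T}, [/\ A \subset C, C \subset B & #|C| = k].
Proof.
move=> AB /andP[Ak kB].
pose D := [set:: take (k - #|A|) (enum (B :\: A))].
have DBA : D \subset B :\: A.
  by apply/subsetP=> i; rewrite inE => /mem_take; rewrite mem_enum.
exists (A :|: D); split; first exact: subsetUl.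
  by rewrite subUset AB (subset_trans DBA) ?subsetDl.
rewrite cardsU; have -> : A :&: D = set0.
  apply/eqP; rewrite -subset0; apply/subsetP=> i; rewrite inE => /andP[iA].
  by move/(subsetP DBA); rewrite inE iA.
rewrite cards0 subn0 /D cardsE (card_uniqP _); last by rewrite take_uniq ?enum_uniq.
rewrite size_take_min -cardE cardsD (setIidPr AB); lia.
Qed.

(** A Helly-type argument. Without a common vertex, take an edge {a,b,c} and edges [ea], [eb], [ec]
    missing a, b, c respectively. Any three edges share a vertex, so [ea] contains b and c, and
    likewise for the other two. The four edges then span few vertices, so they have a common vertex,
    which must be a, b or c: a contradiction. *)
Lemma star_of_small_stars (T : finType) (H : {set {set T}}) (S : {set T}) :
  is3graph H -> S != set0 ->
  (forall U : {set T}, U \subset S -> #|U| <= 7 ->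
     exists w, forall e, e \in H -> e \subset U -> w \in e) ->
  exists w, forall e, e \in H -> e \subset S -> w \in e.
Proof.
move=> H3 /set0Pn[t0 _] Hs.
have int2 e f : e \in H -> f \in H -> e \subset S -> f \subset S -> 0 < #|e :&: f|.
  move=> eH fH eS fS; have [||w Hw] := Hs (e :|: f); first by rewrite subUset eS.
    by rewrite (leq_trans (leq_card_setU _ _)) // (H3 e) // (H3 f).
  by apply/card_gt0P; exists w; rewrite inE !Hw ?subsetUl ?subsetUr.
(* Since the edges meet pairwise, the union of three has at most 9 - 1 - 1 = 7 vertices. *)
have int3 e f g : e \in H -> f \in H -> g \in H ->
    e \subset S -> f \subset S -> g \subset S ->
    exists w, [/\ w \in e, w \in f & w \in g].
  move=> eH fH gH eS fS gS.
  have [||w Hw] := Hs (e :|: f :|: g); first by rewrite !subUset eS fS.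
    have := int2 e f eH fH eS fS; have := int2 e g eH gH eS gS.
    have : #|e :&: g| <= #|(e :|: f) :&: g| by rewrite subset_leq_card // setSI ?subsetUl.
    by rewrite !cardsU (H3 e) // (H3 f) // (H3 g) //; lia.
  exists w; split; apply: Hw => //; last exact: subsetUr.
    by rewrite -setUA subsetUl.
  by rewrite (subset_trans (subsetUr e f)) ?subsetUl.
case: (boolP [exists w, [forall e in H, (e \subset S) ==> (w \in e)]]).
  case/existsP=> w /forall_inP Hw; exists w => e eH eS.
  by move/implyP: (Hw e eH); apply.
move=> /existsPn nw.
have {}nw w : exists e, [/\ e \in H, e \subset S & w \notin e].
  by have /forall_inPn[e eH] := nw w; rewrite negb_imply => /andP[]; exists e.
have [e [eH eS _]] := nw t0.
have [a [b [c [_ De]]]] := cards3P (H3 _ eH).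
have [ea [aH aS nae]] := nw a; have [eb [bH bS nbe]] := nw b.
have [ec [cH cS nce]] := nw c.
have out (f : {set T}) u v : f \in H -> u != v -> u \in e -> v \in e ->
    u \in f -> v \in f -> #|f :\: e| <= 1.
  move=> fH nuv ue ve uf vf.
  have : #|[set u; v]| <= #|f :&: e|.
    by rewrite subset_leq_card // subUset !sub1set !inE uf vf ue ve.
  by rewrite cards2 nuv cardsD (H3 f) // => /(leq_sub2l 3).
have := H3 _ eH; rewrite De => /eqP; rewrite card_set3 /= !inE negb_or andbT.
case/andP=> /andP[nab nac] nbc.
have ae : a \in e by rewrite De !inE eqxx.
have be : b \in e by rewrite De !inE eqxx orbT.
have ce : c \in e by rewrite De !inE eqxx orbT.
have in3 w : w \in e -> [\/ w = a, w = b | w = c].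
  by rewrite De !inE -orbA => /or3P[] /eqP->; constructor.
have [wc [/in3 wce wca wcb]] := int3 _ _ _ eH aH bH eS aS bS.
have [wb [/in3 wbe wba wbc]] := int3 _ _ _ eH aH cH eS aS cS.
have [wa [/in3 wae wab wac]] := int3 _ _ _ eH bH cH eS bS cS.
have {wce wca wcb wc} [ca cb] : c \in ea /\ c \in eb.
  by case: wce wca wcb => -> //; rewrite ?(negPf nae) ?(negPf nbe).
have {wbe wba wbc wb} [ba bc] : b \in ea /\ b \in ec.
  by case: wbe wba wbc => -> //; rewrite ?(negPf nae) ?(negPf nce).
have {wae wab wac wa} [ab ac] : a \in eb /\ a \in ec.
  by case: wae wab wac => -> //; rewrite ?(negPf nbe) ?(negPf nce).
have oa := out _ _ _ aH nbc be ce ba ca.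
have ob := out _ _ _ bH nac ae ce ab cb.
have oc := out _ _ _ cH nab ae be ac bc.
pose U := e :|: (ea :\: e) :|: (eb :\: e) :|: (ec :\: e).
have [||w Hw] := Hs U.
- by rewrite !subUset eS !(subset_trans (subsetDl _ _)).
(* Each of [ea], [eb], [ec] adds at most one vertex to the three of [e]. *)
- apply: (@leq_trans (5 + 1)) => //.
  apply: leq_trans (leq_card_setU _ _) _; apply: leq_add oc.
  apply: leq_trans (leq_card_setU _ _) _; apply: (@leq_add _ _ 4 1) ob.
  apply: leq_trans (leq_card_setU _ _) _; apply: (@leq_add _ _ 3 1) oa.
  by rewrite H3.
have subU f : f \in [:: e; ea; eb; ec] -> f \subset U.
  move=> fin; apply/subsetP=> i fi; rewrite !inE; case ie: (i \in e) => //=.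
  move: fin; rewrite !inE => /or4P[] /eqP Ef; rewrite Ef ?ie in fi => //;
  by rewrite fi ?orbT.
have := Hw e eH (subU _ _); rewrite !inE eqxx => /(_ isT)/in3.
have wa := Hw ea aH (subU _ _); have wb := Hw eb bH (subU _ _).
have wc := Hw ec cH (subU _ _).
case=> E; rewrite E !inE !eqxx !orbT in wa wb wc.
- by have := wa isT; rewrite (negPf nae).
- by have := wb isT; rewrite (negPf nbe).
- by have := wc isT; rewrite (negPf nce).
Qed.

(** * Supports of at most five vertices *)

(* [lab] sends the [p]-th vertex of [s] to a vertex of [G26]; [Ds] lists the
   triples of positions in [s] known to be non-edges of [H]. *)
Lemma weight_labelling_le (T : finType) (H : {set {set T}}) (x : T -> nat)
    (s : seq T) (lab : seq nat) (Ds : seq (seq nat)) :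
  is3graph H -> (forall i, 0 < x i -> i \in s) ->
  all (fun p => p < 6) lab ->
  (forall t0 D, D \in Ds -> [set:: map (nth t0 s) D] \notin H) ->
  all (fun D => size D == 3) Ds ->
  all (fun p => all (fun q => all (fun r => uniq [:: p; q; r] ==>
       (g26 (nth 0 lab p) (nth 0 lab q) (nth 0 lab r)
        || has (fun D => all (mem D) [:: p; q; r]) Ds))
    (iota 0 (size s))) (iota 0 (size s))) (iota 0 (size s)) ->
  27 * weight H x <= 2 * (\sum_i x i) ^ 3.
Proof.
move=> H3 xs lab6 DH D3 chk.
pose phi i : 'I_6 := inord (nth 0 lab (index i s)).
apply: (@weight_hom_G26_le _ _ phi) => // i j k ijkH.
rewrite !muln_gt0 -andbA => /and3P[/xs is_ /xs js /xs ks].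
have labE p : inord (n' := 5) (nth 0 lab p) = nth 0 lab p :> nat.
  rewrite inordK //; case: (ltnP p (size lab)) => [lp|lp]; last by rewrite nth_default.
  by apply: (allP lab6); rewrite mem_nth.
rewrite !labE.
have mi t : t \in s -> index t s \in iota 0 (size s) by rewrite mem_iota index_mem.
have := allP (allP (allP chk _ (mi _ is_)) _ (mi _ js)) _ (mi _ ks).
have uijk : uniq [:: i; j; k] by rewrite -card_set3 (H3 _ ijkH).
have -> : uniq [:: index i s; index j s; index k s].
  move: uijk; rewrite /= !inE; apply: contraTT; rewrite !andbT !negb_and !negbK.
  have inj u v : index u s == index v s -> u \in s -> u == v.
    by move=> /eqP E us; rewrite -(nth_index u us) E nth_index // -index_mem -E index_mem.
  by case/orP=> [/orP[]|] /inj->; rewrite ?orbT.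
case/orP=> // /hasP[D DD] allD.
case/negP: (DH i D DD); suff <- : [set i; j; k] = [set:: map (nth i s) D] by [].
apply/eqP; rewrite eqEcard (H3 _ ijkH); apply/andP; split.
  move: allD => /= /and4P[iD jD kD _].
  have inD t : t \in s -> index t s \in D -> t \in [set:: map (nth i s) D].
    by move=> ts tD; rewrite inE; apply/mapP; exists (index t s); rewrite ?nth_index.
  by rewrite !subUset !sub1set !inD.
by rewrite cardsE (leq_trans (card_size _)) // size_map (eqP (allP D3 _ DD)).
Qed.

(** Otherwise all triples of [S] except possibly [D] are edges, and [S] carries a copy of [K5minus]
    with [D] as the missing triple. *)
Lemma Mfree_other_nonedge (T : finType) (H : {set {set T}}) (S D : {set T}) :
  Mfree H -> #|S| = 5 -> D \subset S -> #|D| = 3 ->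
  exists D' : {set T}, [/\ D' \subset S, #|D'| = 3, D' \notin H & D' != D].
Proof.
move=> HM S5 DS D3.
case: (boolP [exists D' : {set T}, [&& D' \subset S, #|D'| == 3, D' \notin H & D' != D]]).
  by case/existsP=> D' /and4P[? /eqP ? ? ?]; exists D'.
move=> /existsPn nD; case: (HM _ K5minus); first by left; exists id; split; [exists id|move=> e; rewrite imset_id].
have [a [b [c [uabc De]]]] := cards3P D3.
have : #|S :\: D| == 2 by rewrite cardsD (setIidPr DS) S5 D3.
case/cards2P=> d [e [nde SD]].
(* [D] is listed first, so that it is the image of the missing triple {0,1,2}. *)
pose s := [:: a; b; c; d; e].
have us : uniq s.
  have -> : s = [:: a; b; c] ++ [:: d; e] by [].
  rewrite cat_uniq uabc /= mem_seq1 nde !andbT orbF negb_or.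
  have dS : d \in S :\: D by rewrite SD !inE eqxx.
  have eS : e \in S :\: D by rewrite SD !inE eqxx orbT.
  by move: dS eS; rewrite De !inE -!orbA => /andP[-> _] /andP[-> _].
have sS t : t \in s -> t \in S.
  move=> ts; rewrite -(setID S D) (setIidPr DS) SD De inE; move: ts; rewrite !inE.
  by rewrite -!orbA.
pose f (i : 'I_5) := nth a s i.
have fI : injective f.
  by move=> i j /eqP; rewrite nth_uniq // => /eqP/val_inj.
exists f; split=> // E; rewrite inE => /andP[/eqP E3 nE].
apply/negPn/negP=> nfE; case/negP: (nD (f @: E)); rewrite card_imset // E3 nfE /=.
apply/andP; split.
  by apply/subsetP=> _ /imsetP[i _ ->]; apply: sS; apply: mem_nth.
have -> : D = f @: [set inord 0; inord 1; inord 2].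
  by rewrite !imsetU !imset_set1 De /f !inordK.
by apply: contra nE => /eqP/(imset_inj fI)->.
Qed.

(** Five support vertices contain two distinct non-edges, sharing one or two vertices. In either
    case five vertices of [G26] span exactly two non-edges in the same position, and the labels send
    one configuration to the other. *)
Lemma Mfree_weight_le5 (T : finType) (H : {set {set T}}) (x : T -> nat) :
  is3graph H -> Mfree H -> #|[set i | 0 < x i]| <= 5 ->
  27 * weight H x <= 2 * (\sum_i x i) ^ 3.
Proof.
move=> H3 HM; set S := [set i | 0 < x i] => S5.
have xS i : 0 < x i -> i \in S by rewrite inE.
move: S5; rewrite leq_eqVlt => /orP[/eqP S5|S4]; last first.
  (* Every triple of {0,1,3,4} is an edge of [G26]. *)
  apply: (@weight_labelling_le _ H x (enum S) [:: 0; 1; 3; 4] [::]) => //.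
    by move=> i /xS; rewrite mem_enum.
  by rewrite -cardE; move: S4; case: #|S| => [|[|[|[|[]]]]].
have [D0 [_ D0S D03]] : exists D : {set T}, [/\ set0 \subset D, D \subset S & #|D| = 3].
  by apply: exists_set_between; rewrite ?sub0set // cards0 S5.
(* An arbitrary triple gives a first non-edge, which in turn gives a second one. *)
have [D1 [D1S D13 D1H _]] := Mfree_other_nonedge HM S5 D0S D03.
have [D2 [D2S D23 D2H nD]] := Mfree_other_nonedge HM S5 D1S D13.
have D12S : D1 :|: D2 \subset S by rewrite subUset D1S.
have cU : #|D1 :|: D2| = 6 - #|D1 :&: D2| by rewrite cardsU D13 D23.
have c12 : #|D1 :\: D2| = 3 - #|D1 :&: D2| by rewrite cardsD D13.
have c21 : #|D2 :\: D1| = 3 - #|D1 :&: D2| by rewrite cardsD D23 setIC.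
have cS : #|S :\: (D1 :|: D2)| = 5 - (6 - #|D1 :&: D2|).
  by rewrite cardsD (setIidPr D12S) S5 cU.
have I_ge1 : 0 < #|D1 :&: D2|.
  by have := subset_leq_card D12S; rewrite cU S5; lia.
have I_lt3 : #|D1 :&: D2| < 3.
  rewrite ltnNge; apply: contra nD => le3; rewrite eq_sym.
  have -> : D1 = D1 :&: D2 by apply/esym/eqP; rewrite eqEcard subsetIl D13.
  by rewrite eqEcard subsetIr D23.
have D1E : D1 = (D1 :\: D2) :|: (D1 :&: D2) by rewrite setUC setID.
have D2E : D2 = (D1 :&: D2) :|: (D2 :\: D1) by rewrite setIC setID.
have SE i : i \in S -> [|| i \in D1 :\: D2, i \in D1 :&: D2, i \in D2 :\: D1
                       | i \in S :\: (D1 :|: D2)].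
  by move=> iS; rewrite !in_setD !in_setI in_setU iS; case: (i \in D1); case: (i \in D2).
have [I1|I2] : #|D1 :&: D2| = 1 \/ #|D1 :&: D2| = 2 by lia.
- rewrite I1 in c12 c21 cS.
  have /cards1P[c Ec] : #|D1 :&: D2| == 1 by rewrite I1.
  have /cards2P[a [b [_ Eab]]] : #|D1 :\: D2| == 2 by rewrite c12.
  have /cards2P[d [e [_ Ede]]] : #|D2 :\: D1| == 2 by rewrite c21.
  have SD : S :\: (D1 :|: D2) = set0 by apply/eqP; rewrite -cards_eq0 cS.
  apply: (@weight_labelling_le _ H x [:: a; b; c; d; e] [:: 0; 1; 2; 3; 4]
           [:: [:: 0; 1; 2]; [:: 2; 3; 4]]) => //.
    by move=> i /xS/SE; rewrite Ec Eab Ede SD !inE -!orbA orbF.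
  move=> t0 D; rewrite !inE => /orP[] /eqP-> /=.
    suff <- : D1 = [set:: [:: a; b; c]] by [].
    by rewrite D1E Eab Ec; apply/setP=> i; rewrite !inE -?orbA.
  suff <- : D2 = [set:: [:: c; d; e]] by [].
  by rewrite D2E Ede Ec; apply/setP=> i; rewrite !inE -?orbA.
- rewrite I2 in c12 c21 cS.
  have /cards2P[b [c [_ Ebc]]] : #|D1 :&: D2| == 2 by rewrite I2.
  have /cards1P[a Ea] : #|D1 :\: D2| == 1 by rewrite c12.
  have /cards1P[d Ed] : #|D2 :\: D1| == 1 by rewrite c21.
  have /cards1P[e Ee] : #|S :\: (D1 :|: D2)| == 1 by rewrite cS.
  apply: (@weight_labelling_le _ H x [:: a; b; c; d; e] [:: 2; 3; 4; 5; 0]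
           [:: [:: 0; 1; 2]; [:: 1; 2; 3]]) => //.
    by move=> i /xS/SE; rewrite Ea Ebc Ed Ee !inE -!orbA.
  move=> t0 D; rewrite !inE => /orP[] /eqP-> /=.
    suff <- : D1 = [set:: [:: a; b; c]] by [].
    by rewrite D1E Ea Ebc; apply/setP=> i; rewrite !inE -?orbA.
  suff <- : D2 = [set:: [:: b; c; d]] by [].
  by rewrite D2E Ebc Ed; apply/setP=> i; rewrite !inE -?orbA.
Qed.

(** * Supports of six or more vertices, and the upper bound *)

Lemma card_set3_filter (T : finType) (P : pred T) (a b c : T) :
  uniq [:: a; b; c] -> #|[set t in [set a; b; c] | P t]| = P a + P b + P c.
Proof.
move=> u; have -> : [set t in [set a; b; c] | P t] = [set:: filter P [:: a; b; c]].
  by apply/setP=> t; rewrite !inE mem_filter !inE andbC orbA.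
by rewrite cardsE (card_uniqP _) ?filter_uniq // size_filter /= addn0 addnA.
Qed.

(** The support is itself a 6-vertex core. If the bound failed, its trace would lie in [M3], since
    an embedding into [G1] or into a [G2] graph yields a map that proves the bound. *)
Lemma Mfree_weight6 (T : finType) (H : {set {set T}}) (x : T -> nat) :
  is3graph H -> Mfree H -> #|[set i | 0 < x i]| = 6 ->
  covers_pairs H [set i | 0 < x i] ->
  27 * weight H x <= 2 * (\sum_i x i) ^ 3.
Proof.
move=> H3 HM; set S := [set i | 0 < x i] => S6 cov.
have /card_gt0P[t0 t0S] : 0 < #|S| by rewrite S6.
pose rho := enum_rank_in t0S.
have rhoE i j k : [set i; j; k] \in H -> 0 < x i * x j * x k ->
    [set rho i; rho j; rho k] \in trace H S.
  move=> ijkH; rewrite !muln_gt0 -andbA => /and3P[xi xj xk].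
  by rewrite inE !imsetU !imset_set1 !enum_rankK_in // inE.
rewrite leqNgt; apply/negP => gt.
case: (HM _ (trace H S)); last exact: trace_contained.
right; right; split; last split.
- split; first exact: trace_is3graph.
  split; first by rewrite S6.
  by eexists; apply: (trace_is_core (subxx S)).
- move=> n _ [g [gI gF]].
  move: gt; rewrite ltnNge => /negP[].
  apply: (@weight_cross_le _ _ (fun i => g (rho i) < n %/ 3)) => // i j k ijkH x0.
  have := gF _ (rhoE _ _ _ ijkH x0).
  rewrite !imsetU !imset_set1 inE card_set3 => /andP[u].
  by rewrite card_set3_filter // => /eqP.
- move=> n _ _ [f [_ [-> _]]] [g [gI gF]].
  move: gt; rewrite ltnNge => /negP[].
  apply: (@weight_hom_G26_le _ _ (fun i => f (g (rho i)))) => // i j k ijkH x0.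
  have := gF _ (rhoE _ _ _ ijkH x0).
  by rewrite !imsetU !imset_set1 in_blowup26.
Qed.

Lemma Mfree_weight_ge7 (T : finType) (H : {set {set T}}) (x : T -> nat) :
  is3graph H -> Mfree H -> 7 <= #|[set i | 0 < x i]| ->
  covers_pairs H [set i | 0 < x i] ->
  27 * weight H x <= 2 * (\sum_i x i) ^ 3.
Proof.
move=> H3 HM; set S := [set i | 0 < x i] => S7 cov.
have [||w Hw] := @star_of_small_stars _ H S H3.
- by rewrite -card_gt0; apply: leq_trans S7.
(* A small subset of the support extends to a 7-set, which is a core because all pairs are
   covered. *)
- move=> U US U7; have [|U' [UU' U'S U'7]] := @exists_set_between _ U S 7 US.
    by rewrite U7.
  have [|w Hw] := @Mfree_core7_star _ H U' H3 HM.
    split=> // u v uU vU nuv.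
    have [e eH /and3P[_ ue ve]] := cov u v (subsetP U'S _ uU) (subsetP U'S _ vU) nuv.
    by exists e; rewrite ?ue.
  by exists w => e eH eU; apply: Hw => //; apply: subset_trans UU'.
(* A star is the cross pattern whose first part is its centre alone. *)
apply: (@weight_cross_le _ _ (pred1 w)) => // i j k ijkH x0.
have u : uniq [:: i; j; k] by rewrite -card_set3 (H3 _ ijkH).
rewrite -card_set3_filter //.
have -> : [set t in [set i; j; k] | pred1 w t] = [set w].
  apply/setP=> t; rewrite in_set in_set1 /=; case: (t =P w) => [->|]; rewrite ?andbF ?andbT //.
  have := Hw _ ijkH; rewrite !inE; apply.
  move: x0; rewrite !muln_gt0 -andbA => /and3P[xi xj xk].
  by rewrite !subUset !sub1set !inE xi xj xk.
by rewrite cards1.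
Qed.

Lemma Mfree_card_le n (H : {set {set 'I_n}}) :
  is3graph H -> Mfree H -> 27 * #|H| <= 2 * n ^ 3.
Proof.
move=> H3 HM.
have := @weight_le_of_2covered _ H _ (fun=> 1).
rewrite weight1 sum1_card card_ord; apply=> x cov.
have [le5|] := leqP #|[set i | 0 < x i]| 5; first exact: Mfree_weight_le5.
by rewrite leq_eqVlt => /orP[/eqP/esym ?|?]; [exact: Mfree_weight6|exact: Mfree_weight_ge7].
Qed.

(** * The balanced blowup attains the bound *)

Section BalancedBlowup.
Variable k : nat.

Definition residue6 (i : 'I_(6 * k)) : 'I_6 := inord (i %% 6).

Lemma residue6E i : residue6 i = i %% 6 :> nat.
Proof. by rewrite inordK // ltn_mod. Qed.

Lemma residue6_onto : 0 < k -> forall p, exists i, residue6 i = p.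
Proof.
move=> k0 p; have lt : p < 6 * k by have := ltn_ord p; lia.
by exists (Ordinal lt); apply: ord_inj; rewrite residue6E /= modn_small.
Qed.

Lemma pushforward_residue6 p : pushforward residue6 (fun=> 1) p = k.
Proof.
rewrite /pushforward (eq_bigl (fun i : 'I_(6 * k) => i %% 6 == p)); last first.
  by move=> i; rewrite -val_eqE /= residue6E.
rewrite -(big_mkord (fun i => i %% 6 == p) (fun=> 1)).
(* Each block of six consecutive integers contains every residue once. *)
elim: k => [|m IH]; first by rewrite muln0 big_geq.
have -> : 6 * m.+1 = 6 * m + 6 by lia.
rewrite (big_cat_nat _ (n := 6 * m)) ?leq_addr //= IH -[RHS]addn1; congr (_ + _).
have -> : \sum_(6 * m <= i < 6 * m + 6 | i %% 6 == p) 1 =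
          \sum_(0 <= i < 6 | (i + 6 * m) %% 6 == p) 1.
  by rewrite -{1}[6 * m]add0n big_addn addKn.
under eq_bigl => i do rewrite addnC mulnC modnMDl.
by rewrite unlock /=; case: p {IH} => [[|[|[|[|[|[|]]]]]]].
Qed.

(** The 16 edges of [G26] contribute k^3 each, and 27 * 16 = 2 * 6^3. *)
Lemma card_balanced_blowup26 : 27 * #|blowup26 residue6| = 2 * (6 * k) ^ 3.
Proof.
have := weight_pattern_eq (P := fun p q r : 'I_6 => g26 p q r) (fun=> 1)
  (@blowup26_is3graph _ residue6) (in_blowup26 residue6).
rewrite weight1 => E6.
have E : 6 * #|blowup26 residue6| =
    \sum_(p < 6) \sum_(q < 6) \sum_(r < 6 | g26 p q r) k * k * k.
  by rewrite E6; do 3!(apply: eq_bigr => ? _); rewrite !pushforward_residue6.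
by rewrite (sum_g26 (fun=> k)) in E; rewrite !expnS expn0; lia.
Qed.

(** It attains the upper bound valid for every blowup of [G26], hence is a largest one. *)
Lemma balanced_blowup26_isG2 : 0 < k -> isG2 (blowup26 residue6).
Proof.
move=> k0; exists residue6; split; first exact: residue6_onto.
split=> // g _; rewrite -(leq_pmul2l (isT : 0 < 27)) card_balanced_blowup26.
exact: card_blowup26_le.
Qed.

End BalancedBlowup.

(** * Forbidden subgraphs of the balanced blowup *)

Lemma blowup26_injective_on_edge m n (f : 'I_n -> 'I_6) (g : 'I_m -> 'I_n)
    (e : {set 'I_m}) (u v : 'I_m) :
  #|e| = 3 -> g @: e \in blowup26 f -> u \in e -> v \in e -> f (g u) = f (g v) -> u = v.
Proof.
rewrite inE => e3 /and3P[_ /eqP fge _] ue ve.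
have /imset_injP inj : #|(f \o g) @: e| == #|e| by rewrite imset_comp fge e3.
exact: inj.
Qed.

(** Two core vertices lie in a common edge, so they fall into different parts; the core injects into
    the six parts. *)
Lemma blowup26_no_core n (f : 'I_n -> 'I_6) l m (F : {set {set 'I_m}}) (S : {set 'I_m}) :
  is3graph F -> is_core l F S -> contained F (blowup26 f) -> l < 6.
Proof.
move=> F3 [Sl cov] [g [_ gF]].
have inj : {in S &, injective (f \o g)}.
  move=> u v uS vS E; apply/eqP; apply: contraT => nuv.
  have [e eF /andP[ue ve]] := cov u v uS vS nuv.
  by case/eqP: nuv; apply: (blowup26_injective_on_edge (F3 _ eF) (gF _ eF)).
rewrite -Sl -(card_in_imset inj) -[leqRHS](card_ord 6); exact: max_card.
Qed.

(** Every pair of the five labels occurs in one of the nine triples, so the labels would be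
    distinct. But each vertex of [G26] lies in only two of the four non-edges, so any five vertices
    span two non-edges. The check is by exhaustion. *)
Lemma g26_K5minus_free :
  all (fun p0 => all (fun p1 => all (fun p2 => all (fun p3 => all (fun p4 =>
    ~~ [&& g26 p0 p1 p3, g26 p0 p1 p4, g26 p0 p2 p3, g26 p0 p2 p4, g26 p0 p3 p4,
           g26 p1 p2 p3, g26 p1 p2 p4, g26 p1 p3 p4 & g26 p2 p3 p4])
  (iota 0 6)) (iota 0 6)) (iota 0 6)) (iota 0 6)) (iota 0 6).
Proof. by vm_compute. Qed.

Lemma blowup26_K5minus_free n (f : 'I_n -> 'I_6) : ~ contained K5minus (blowup26 f).
Proof.
move=> [g [gI gF]].
have gE (a b c : nat) : a < 5 -> b < 5 -> c < 5 -> uniq [:: a; b; c] ->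
    ~~ all (mem [:: 0; 1; 2]) [:: a; b; c] ->
    g26 (f (g (inord a))) (f (g (inord b))) (f (g (inord c))).
  move=> ha hb hc u nabc; rewrite -in_blowup26.
  have <- : g @: [set inord a; inord b; inord c] =
      [set g (inord a); g (inord b); g (inord c)] by rewrite !imsetU !imset_set1.
  apply: gF.
  have v (a' b' c' : nat) : a' < 5 -> b' < 5 -> c' < 5 -> uniq [:: a'; b'; c'] ->
      uniq [:: inord a'; inord b'; inord c' : 'I_5].
    by move=> *; rewrite -(map_inj_uniq val_inj) /= !inordK.
  rewrite inE card_set3 v //= eq_set3 ?v //; last first.
    by apply/eqP; rewrite card_set3 v.
  apply: contra nabc; rewrite /= !inE -!val_eqE /= !inordK //.
  by rewrite !orbA.
have mem6 (p : 'I_6) : (p : nat) \in iota 0 6 by rewrite mem_iota; exact: ltn_ord.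
pose h a := f (g (inord a)).
have /negP[] := allP (allP (allP (allP (allP g26_K5minus_free _ (mem6 (h 0))) _
  (mem6 (h 1))) _ (mem6 (h 2))) _ (mem6 (h 3))) _ (mem6 (h 4)).
by rewrite !gE.
Qed.

Lemma balanced_blowup26_Mfree k : 0 < k -> Mfree (blowup26 (@residue6 k)).
Proof.
move=> k0 m F [[h [hb hF]]|[[[F3 _] [S [coreS _]]]|[_ [_ nG2]]]] FH.
- apply: (@blowup26_K5minus_free _ (@residue6 k)); case: FH => g [gI gF].
  case: hb => h' hK h'K; exists (g \o h'); split.
    by apply: inj_comp => //; apply: can_inj h'K.
  move=> e eK; rewrite imset_comp; apply: gF; rewrite hF -imset_comp.
  by rewrite (eq_imset _ (g := id)) ?imset_id.
- by have := blowup26_no_core F3 coreS FH.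
- apply: nG2 FH; last exact: balanced_blowup26_isG2.
  by rewrite leq_pmulr.
Qed.

Theorem theorem1p7 :
  (forall n : nat, 0 < n ->
     forall H : {set {set 'I_n}}, is3graph H -> Mfree H -> 27 * #|H| <= 2 * n ^ 3)
  /\
  (forall n : nat, 0 < n -> 6 %| n ->
     exists H : {set {set 'I_n}}, [/\ is3graph H, Mfree H & 27 * #|H| = 2 * n ^ 3]).
Proof.
split=> [n _ H|n n0 /dvdnP[k Ek]]; first exact: Mfree_card_le.
move: n0; rewrite {}Ek mulnC muln_gt0 => /andP[_ k0].
exists (blowup26 (@residue6 k)); split.
- exact: blowup26_is3graph.
- exact: balanced_blowup26_Mfree.
- exact: card_balanced_blowup26.
Qed.
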